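(* Let $\mathbf{X},\mathbf{Y}$ be quasivarieties and let $\langle\zeta,f\rangle:Tm(\mathcal{L}_{\mathbf{X}})\to Tm(\mathcal{L}_{\mathbf{Y}})$ be a sober translation. Then the assignment $\tau:\Xi(\mathbf{X})\to\Xi^f(\mathbf{Y})$, $\tau(\mathbf{K})=\{\mathcal{A}\in\mathbf{Y}:\theta(\mathcal{A})\in\mathbf{K}\}$, is a lattice isomorphism.
   Context: A quasivariety is a class of similar algebras closed under isomorphisms, subalgebras and reduced products. $\mathbf{X},\mathbf{Y}$ have languages $\mathcal{L}_{\mathbf{X}},\mathcal{L}_{\mathbf{Y}}$; $\Xi(\mathbf{K})$ is the lattice of subquasivarieties of $\mathbf{K}$. For a class $\mathbf{K}$, $\Phi\vDash_{\mathbf{K}}\lambda\approx\gamma$ means every assignment into an algebra of $\mathbf{K}$ satisfying $\Phi$ satisfies $\lambda\approx\gamma$. Selective translation: $\zeta$ assigns to each $n$-ary symbol $g\in\mathcal{L}_{\mathbf{X}}$ an $n$-ary term $\zeta(g)$ of $\mathcal{L}_{\mathbf{Y}}$; $f(x)$ is a unary term of $\mathcal{L}_{\mathbf{Y}}$ (the selector). For an infinite variable set $V$ define $\zeta_*:Tm(\mathcal{L}_{\mathbf{X}},V)\to Tm(\mathcal{L}_{\mathbf{Y}},V)$ by $\zeta_*(x)=f(x)$ on variables and $\zeta_*(g(\phi_1,\dots,\phi_n))=\zeta(g)(\zeta_*(\phi_1),\dots,\zeta_*(\phi_n))$ (in particular $\zeta_*(c)=\zeta(c)$ for constants), and $\zeta^*(\Phi)=\{\zeta_*(\delta)\approx\zeta_*(\gamma):\delta\approx\gamma\in\Phi\}$.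 $\langle\zeta,f\rangle$ is a selective translation if: (i) $\vDash_{\mathbf{Y}}f(f(x))\approx f(x)$; (ii) $\Phi\vDash_{\mathbf{X}}\lambda\approx\gamma$ implies $\zeta^*(\Phi)\cup\{f(x)\approx x:x\in V\}\vDash_{\mathbf{Y}}\zeta^*(\lambda\approx\gamma)$; (iii) for each $n$-ary $g\in\mathcal{L}_{\mathbf{X}}$, $\{f(x_i)\approx x_i:i\le n\}\vDash_{\mathbf{Y}}f(\zeta(g)(x_1,\dots,x_n))\approx\zeta(g)(x_1,\dots,x_n)$. For $\mathcal{A}\in\mathbf{Y}$, $\mathcal{A}^f=\{a\in A:f(a)=a\}$, and $\theta(\mathcal{A})\in\mathbf{X}$ is the algebra with universe $\mathcal{A}^f$ and operations $g^{\theta(\mathcal{A})}=\zeta(g)^{\mathcal{A}}$ restricted to $\mathcal{A}^f$. With restriction on homomorphisms, $\theta:\mathbf{Y}\to\mathbf{X}$ is a right adjoint functor; $\mathcal{F}:\mathbf{X}\to\mathbf{Y}$ is its left adjoint, with unit $\eta:1\Rightarrow\theta\mathcal{F}$ and counit $\varepsilon:\mathcal{F}\theta\Rightarrow1$. A selective translation is strongly selective if $\eta$ is an isomorphism, and sober if moreover $\varepsilon$ is pointwise injective and $\mathcal{F}$ preserves injective homomorphisms. For $\mathcal{A},\mathcal{B}\in\mathbf{Y}$, $\mathcal{B}\preceq_f\mathcal{A}$ means $\mathcal{B}$ is a subalgebra of $\mathcal{A}$ with $\mathcal{B}^f=\mathcal{A}^f$; for $\mathbf{K}\in\Xi(\mathbf{Y})$,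 $\mathbf{K}^\uparrow=\{\mathcal{A}\in\mathbf{Y}:\exists\mathcal{B}\in\mathbf{K},\ \mathcal{B}\preceq_f\mathcal{A}\}$; $\Xi^f(\mathbf{Y})=\{\mathbf{K}^\uparrow:\mathbf{K}\in\Xi(\mathbf{Y})\}$ is the complete lattice (under inclusion) of $\mathsf{PAt}$-$f$-quasivarieties. *)

(* Defs.v *)
From HB Require Import structures.
From Stdlib Require List.
From mathcomp Require Import all_boot all_order.
From mathcomp Require Import boolp classical_sets functions cardinality filter.

Set Implicit Arguments.
Unset Strict Implicit.
Unset Printing Implicit Defensive.

Local Open Scope classical_set_scope.

Identity Coercion set_to_fun : set >-> Funclass.

(* The ordinal type 'I_n is declared in the universe of predArgType, too large
   for the terms to serve as indices of a reduced product. *)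
Definition fin (n : nat) : Set := {i : nat | (i < n)%N}.

Definition fin_ord (n : nat) (i : 'I_n) : fin n := exist _ (val i) (ltn_ord i).

Lemma fin_ord_surj (n : nat) (i : fin n) : exists j : 'I_n, fin_ord j = i.
Proof. by case: i => i lt_in; exists (Ordinal lt_in); apply: eq_exist. Qed.

Lemma filter_fin (I : Type) (F : set_system I) (n : nat) (P : fin n -> set I) :
  Filter F -> (forall k, F (P k)) -> F [set i | forall k, P k i].
Proof.
move=> FF FP; have H : F [set i | forall j : 'I_n, P (fin_ord j) i].
  by apply: filter_forall => j; exact: FP.
apply: filterS H => i H k; have [j <-] := fin_ord_surj k; exact: H.
Qed.

Lemma fin_list (n : nat) : exists s : seq (fin n), forall i, List.In i s.
Proof.
exists [seq fin_ord j | j <- enum 'I_n] => i; have [j <-] := fin_ord_surj i.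
have : j \in enum 'I_n by rewrite mem_enum.
by elim: (enum _) => //= k s IH; rewrite inE => /orP[/eqP ->|/IH];
  [left|right].
Qed.

Definition fin_enum (n : nat) : seq (fin n) := sval (cid (fin_list n)).

Record language := Language { symbol : Type; arity : symbol -> nat }.

Record algebra (L : language) := Algebra {
  carrier :> Type;
  op : forall g : symbol L, (fin (arity g) -> carrier) -> carrier;
  alg_nonempty : inhabited carrier
}.

Inductive term (L : language) (V : Type) : Type :=
| Var of V
| App (g : symbol L) of (fin (arity g) -> term L V).

Arguments Var {L V}.
Arguments App {L V} g.

Fixpoint subst (L : language) (V W : Type) (s : V -> term L W) (t : term L V) :
    term L W :=
  match t with
  | Var x => s x
  | App g ts => App g (fun i => subst s (ts i))
  end.

Fixpoint eval (L : language) (V : Type) (A : algebra L) (h : V -> A)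
    (t : term L V) : A :=
  match t with
  | Var x => h x
  | App g ts => op (fun i => eval h (ts i))
  end.

Lemma eval_subst (L : language) (V W : Type) (A : algebra L) (h : W -> A)
    (s : V -> term L W) (t : term L V) :
  eval h (subst s t) = eval (fun x => eval h (s x)) t.
Proof. by elim: t => //= g ts IH; congr op; apply: funext => i. Qed.

Record hom (L : language) (A B : algebra L) := Hom {
  hom_fun :> A -> B;
  homP : forall (g : symbol L) (a : fin (arity g) -> A),
    hom_fun (op a) = op (fun i => hom_fun (a i))
}.

Lemma hom_eq (L : language) (A B : algebra L) (h k : hom A B) : h =1 k -> h = k.
Proof.
case: h k => [h hP] [k kP] /= /funext E; case: _ / E in kP *.
by congr Hom; apply: Prop_irrelevance.
Qed.

Lemma hom_eval (L : language) (V : Type) (A B : algebra L) (k : hom A B)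
    (h : V -> A) (t : term L V) :
  k (eval h t) = eval (fun x => k (h x)) t.
Proof.
by elim: t => //= g ts IH; rewrite homP; congr op; apply: funext => i.
Qed.

Definition id_hom (L : language) (A : algebra L) : hom A A :=
  @Hom L A A idfun (fun _ _ => erefl).

Lemma comp_homP (L : language) (A B C : algebra L) (k : hom B C) (h : hom A B)
    (g : symbol L) (a : fin (arity g) -> A) :
  (k \o h) (op a) = op (fun i => (k \o h) (a i)).
Proof. by rewrite /= !homP. Qed.

Definition comp_hom (L : language) (A B C : algebra L) (k : hom B C)
  (h : hom A B) : hom A C := Hom (comp_homP k h).

Definition isomorphic (L : language) (A B : algebra L) : Prop :=
  exists h : hom A B, bijective h.

Record subuniverse (L : language) (A : algebra L) := Subuniverse {
  su_set :> set A;
  su_nonempty : su_set !=set0;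
  su_closed : forall (g : symbol L) (a : fin (arity g) -> A),
    (forall i, su_set (a i)) -> su_set (op a)
}.

Lemma subalg_inh (L : language) (A : algebra L) (S : subuniverse A) :
  inhabited {a : A | S a}.
Proof. by case: (su_nonempty S) => a Sa; exact: (inhabits (exist _ a Sa)). Qed.

Definition subalg (L : language) (A : algebra L) (S : subuniverse A) :
    algebra L :=
  @Algebra L {a : A | S a}
    (fun g a => exist _ (op (fun i => sval (a i)))
                  (su_closed (fun i => svalP (a i))))
    (subalg_inh S).

Section ReducedProduct.
Variables (L : language) (I : Type) (A : I -> algebra L) (F : set_system I).

(* Plain predicates, rather than sets in the sense of classical_sets, are used
   for the classes: the universe of carriers has to stay below the one of
   [set (algebra L)]. *)
Definition rp_class (a : forall i, A i) : (forall i, A i) -> Prop :=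
  fun b => F [set i | a i = b i].

Definition rp_carrier : Type :=
  {c : (forall i, A i) -> Prop | exists a, c = rp_class a}.

Definition rp_pi (a : forall i, A i) : rp_carrier :=
  exist _ (rp_class a) (ex_intro _ a erefl).

Definition rp_repr (c : rp_carrier) : forall i, A i := sval (cid (svalP c)).

Lemma rp_inh : inhabited rp_carrier.
Proof.
have h i : exists a : A i, True by case: (alg_nonempty (A i)) => a; exists a.
exact: (inhabits (rp_pi (fun i => sval (cid (h i))))).
Qed.

Definition reduced_product : algebra L :=
  @Algebra L rp_carrier
    (fun g c => rp_pi (fun i => op (fun k => rp_repr (c k) i))) rp_inh.

Hypothesis FF : Filter F.

Lemma rp_reprK : cancel rp_repr rp_pi.
Proof.
move=> c; rewrite /rp_repr; case: cid => a /= E.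
by case: c E => c cP /= E; rewrite /rp_pi; subst c; congr exist;
  apply: Prop_irrelevance.
Qed.

Lemma rp_pi_eq (a b : forall i, A i) :
  rp_pi a = rp_pi b <-> F [set i | a i = b i].
Proof.
split=> [/(congr1 sval) /= E|Fab].
  have : rp_class b b by rewrite /rp_class; apply: filterS filterT.
  by rewrite -E.
have E : rp_class a = rp_class b.
  apply: funext => c; apply: propext; rewrite /rp_class; split=> Fc.
    by apply: filterS (filterI Fab Fc) => i /= [-> ->].
  by apply: filterS (filterI Fab Fc) => i /= [-> ->].
by rewrite /rp_pi; case: _ / E (ex_intro _ b _) => ?; congr exist;
  apply: Prop_irrelevance.
Qed.

Lemma rp_op (g : symbol L) (a : fin (arity g) -> forall i, A i) :
  @op L reduced_product g (fun k => rp_pi (a k))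
    = rp_pi (fun i => op (fun k => a k i)).
Proof.
apply/rp_pi_eq.
have H k : F [set i | rp_repr (rp_pi (a k)) i = a k i].
  by apply/rp_pi_eq; rewrite rp_reprK.
have : F [set i | forall k, rp_repr (rp_pi (a k)) i = a k i].
  by apply: filter_fin.
by apply: filterS => i h /=; congr op; apply: funext => k.
Qed.

End ReducedProduct.

(* [Filter F] does not exclude the improper filter, and the index type [I] may
   be empty, so that every quasivariety contains the one-element algebras. *)
Record is_quasivariety (L : language) (K : set (algebra L)) : Prop := {
  qv_iso : forall A B, isomorphic A B -> K A -> K B;
  qv_sub : forall (A : algebra L) (S : subuniverse A), K A -> K (subalg S);
  qv_rp : forall (I : Type) (A : I -> algebra L) (F : set_system I),
    Filter F -> (forall i, K (A i)) -> K (reduced_product A F)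
}.

Record quasivariety (L : language) := Quasivariety {
  qv_class :> set (algebra L);
  qvP : is_quasivariety qv_class
}.

Definition equation (L : language) (V : Type) := (term L V * term L V)%type.

Definition sat (L : language) (V : Type) (A : algebra L) (h : V -> A)
  (e : equation L V) : Prop := eval h e.1 = eval h e.2.

Definition entails (L : language) (K : set (algebra L)) (V : Type)
    (Phi : set (equation L V)) (e : equation L V) : Prop :=
  forall A, K A -> forall h : V -> A, Phi `<=` sat h -> sat h e.

(* A unary term f is a term in the variable [tt]; [app1 f t] is f(t). *)
Definition app1 (L : language) (W : Type) (f : term L unit) (t : term L W) :
  term L W := subst (fun=> t) f.

Fixpoint zeta_star (LX LY : language)
    (zeta : forall g : symbol LX, term LY (fin (arity g))) (f : term LY unit)
    (V : Type) (t : term LX V) : term LY V :=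
  match t with
  | Var x => app1 f (Var x)
  | App g ts => subst (fun i => zeta_star zeta f (ts i)) (zeta g)
  end.

Definition zeta_star_eq (LX LY : language)
    (zeta : forall g : symbol LX, term LY (fin (arity g))) (f : term LY unit)
    (V : Type) (e : equation LX V) : equation LY V :=
  (zeta_star zeta f e.1, zeta_star zeta f e.2).

Definition selector_fixed (L : language) (f : term L unit) (W : Type) :
    set (equation L W) :=
  [set e | exists x : W, e = (app1 f (Var x), Var x)].
Arguments selector_fixed {L} f W.

Record selective_translation (V : Type) (LX LY : language)
    (X : quasivariety LX) (Y : quasivariety LY) := SelectiveTranslation {
  zeta : forall g : symbol LX, term LY (fin (arity g));
  selector : term LY unit;
  st_infinite : infinite_set [set: V];
  st_idem : @entails LY Y unit (@set0 (equation LY unit)) (app1 selector selector, selector);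
  st_entails : forall (Phi : set (equation LX V)) (e : equation LX V),
    @entails LX X V Phi e ->
    @entails LY Y V
      ((@zeta_star_eq LX LY zeta selector V @` Phi) `|`
       selector_fixed selector V)
      (zeta_star_eq zeta selector e);
  st_closed : forall g : symbol LX,
    @entails LY Y (fin (arity g)) (selector_fixed selector (fin (arity g)))
      (app1 selector (zeta g), zeta g)
}.

Arguments st_idem {V LX LY X Y} s.
Arguments st_entails {V LX LY X Y} s {Phi e}.
Arguments st_closed {V LX LY X Y} s g.

(* The full subcategory of algebras lying in a class. *)
Record obj (L : language) (K : set (algebra L)) := Obj {
  obj_alg :> algebra L;
  objP : K obj_alg
}.

Record functor (L M : language) (K : set (algebra L)) (N : set (algebra M)) :=
  Functor {
  fobj :> obj K -> obj N;
  fmap : forall A B : obj K, hom A B -> hom (fobj A) (fobj B);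
  fmap_id : forall A : obj K, fmap (id_hom A) = id_hom (fobj A);
  fmap_comp : forall (A B C : obj K) (k : hom B C) (h : hom A B),
    @fmap A C (comp_hom k h) = comp_hom (fmap k) (fmap h)
}.

Record left_adjoint (L M : language) (K : set (algebra L)) (N : set (algebra M))
    (G : functor N K) := LeftAdjoint {
  lfun :> functor K N;
  adj_unit : forall A : obj K, hom A (G (lfun A));
  adj_counit : forall B : obj N, hom (lfun (G B)) B;
  adj_unit_nat : forall (A B : obj K) (h : hom A B),
    comp_hom (adj_unit B) h = comp_hom (fmap G (fmap lfun h)) (adj_unit A);
  adj_counit_nat : forall (A B : obj N) (h : hom A B),
    comp_hom (adj_counit B) (fmap lfun (fmap G h)) = comp_hom h (adj_counit A);
  adj_triangle_l : forall A : obj K,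
    comp_hom (adj_counit (lfun A)) (fmap lfun (adj_unit A)) = id_hom (lfun A);
  adj_triangle_r : forall B : obj N,
    comp_hom (fmap G (adj_counit B)) (adj_unit (G B)) = id_hom (G B)
}.

Section Membership.
(* Maltsev's theorem, for implications with possibly infinitely many premises
   over an arbitrary infinite set of variables: it is what makes theta land
   in X. *)
Variables (L : language) (V : Type) (infV : infinite_set [set: V]).
Variables (K : quasivariety L) (A : algebra L).
Hypothesis AK : forall (Phi : set (equation L V)) (e : equation L V),
  entails K Phi e -> forall h : V -> A, Phi `<=` sat h -> sat h e.

Fixpoint vars (t : term L A) : seq A :=
  match t with
  | Var x => [:: x]
  | App g ts => List.flat_map (fun i => vars (ts i)) (fin_enum (arity g))
  end.

Lemma eval_vars (B : algebra L) (h k : A -> B) (t : term L A) :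
  (forall x, List.In x (vars t) -> h x = k x) -> eval h t = eval k t.
Proof.
elim: t => [x|g ts IH] /= H; first by apply: H; left.
congr op; apply: funext => i; apply: IH => x xi; apply: H.
apply/List.in_flat_map; exists i; split=> //.
exact: svalP (cid (fin_list _)) i.
Qed.

Lemma rename_vars (s : seq A) (w0 : A) :
  exists (r : A -> V) (q : V -> A), forall w, List.In w s -> q (r w) = w.
Proof.
have /infiniteP /card_leP [i] := infV.
pose j (n : nat) : V := val (i (SigSub (mem_setT n))).
have jI : injective j.
  by move=> m n /val_inj E; have /(congr1 val) := inj (mem_setT _) (mem_setT _) E.
have [e eP] : exists e : A -> nat,
    forall w w', List.In w s -> e w = e w' -> w = w'.
  elim: s => [|a s [e eP]]; first by exists (fun=> 0).
  exists (fun w => if pselect (w = a) then 0 else (e w).+1) => w w'.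
  case: pselect => wa; case: pselect => w'a //=; first by rewrite wa w'a.
  by move=> [/esym //|ws] [E]; exact: eP.
pose r w := j (e w).
have ex v : exists w, forall w', List.In w' s -> r w' = v -> w = w'.
  have [[w [ws rw]]|no] := pselect (exists w, List.In w s /\ r w = v).
    by exists w => w' w's; rewrite -rw => /jI E; apply: eP.
  by exists w0 => w' w's rw'; case: no; exists w'.
by have [q qP] := choice ex; exists r, q => w ws; exact: qP ws erefl.
Qed.

Let true_eq (e : equation L A) : Prop := sat idfun e.

Let index_type : Type :=
  {p : seq (equation L A) * equation L A
  | (forall e, List.In e p.1 -> true_eq e) /\ ~ true_eq p.2}.

Lemma refute (p : index_type) : exists (B : algebra L) (h : A -> B),
  [/\ K B, forall e, List.In e (sval p).1 -> sat h e & ~ sat h (sval p).2].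
Proof.
apply: contrapT => nB; case: p nB => -[G d] /= [Gtrue dfalse] nB.
apply: dfalse; have [a0] := alg_nonempty A.
pose ev (e : equation L A) : seq A := vars e.1 ++ vars e.2.
pose s : seq A := ev d ++ List.flat_map ev G.
have [r [q rq]] := rename_vars s a0.
pose ren (t : term L A) : term L V := subst (fun a => Var (r a)) t.
pose rene (e : equation L A) : equation L V := (ren e.1, ren e.2).
have evd (e : equation L A) :
    (forall x, List.In x (ev e) -> List.In x s) ->
    sat q (rene e) <-> true_eq e.
  move=> es; rewrite /sat /true_eq /= /ren !eval_subst /=.
  rewrite (@eval_vars A _ idfun e.1); last first.
    by move=> x xe; apply: rq; apply: es; apply/List.in_app_iff; left.
  rewrite (@eval_vars A _ idfun e.2) //.
  by move=> x xe; apply: rq; apply: es; apply/List.in_app_iff; right.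
apply/evd; first by move=> x xd; apply/List.in_app_iff; left.
apply: (@AK [set rene e | e in [set e | List.In e G]]).
  move=> B KB h hG; apply: contrapT => nd; apply: nB; exists B, (h \o r).
  have E t : eval h (ren t) = eval (h \o r) t by rewrite /ren eval_subst.
  split=> //; last by move: nd; rewrite /sat /= !E.
  move=> e eG; have /hG : [set rene e | e in [set e | List.In e G]] (rene e).
    by exists e.
  by rewrite /sat /= !E.
move=> _ [e eG <-]; apply/evd; last exact: Gtrue.
move=> x xe; apply/List.in_app_iff; right; apply/List.in_flat_map.
by exists e.
Qed.

Lemma quasivariety_mem : K A.
Proof.
have [B0 B0P] := choice refute.
pose h p := sval (cid (B0P p)); have hP p : [/\ K (B0 p), forall e, List.In e (sval p).1 -> sat (h p) e
  & ~ sat (h p) (sval p).2] := svalP (cid (B0P p)).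
have KB p : K (B0 p) by case: (hP p).
pose F : set_system index_type := [set S | exists2 G : seq (equation L A),
  (forall e, List.In e G -> true_eq e) &
  forall p, (forall e, List.In e G -> List.In e (sval p).1) -> S p].
have FF : Filter F.
  split.
  - by exists [::].
  - move=> S T [G Gt GS] [G' Gt' GT]; exists (G ++ G').
      by move=> e /List.in_app_iff [/Gt|/Gt'].
    by move=> p H; split; [apply: GS|apply: GT] => e eG; apply: H;
      apply/List.in_app_iff; [left|right].
  - by move=> S T ST [G Gt GS]; exists G => // p /GS /ST.
pose C := reduced_product B0 F.
pose phi (a : A) : C := rp_pi F (fun p => h p a).
have phi_op (g : symbol L) (a : fin (arity g) -> A) :
    phi (op a) = op (fun i => phi (a i)).
  rewrite /phi rp_op; apply/rp_pi_eq.
  exists [:: (Var (op a), App g (fun i => Var (a i)))].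
    by move=> e [<-|[]].
  move=> p H; have [_ ht _] := hP p.
  by have := ht _ (H _ (or_introl erefl)).
have phi_inj : injective phi.
  move=> a b /rp_pi_eq [G Gt GS]; apply: contrapT => ab.
  pose p : index_type := exist _ (G, (Var a, Var b)) (conj Gt ab).
  by have [_ _] := hP p; apply; apply: (GS p).
have S0 : range phi !=set0 by case: (alg_nonempty A) => a; exists (phi a), a.
have S1 (g : symbol L) (c : fin (arity g) -> C) :
    (forall i, range phi (c i)) -> range phi (op c).
  move=> H; have H' i : exists a, phi a = c i by case: (H i) => a _; exists a.
  have [a aP] := choice H'; exists (op a) => //; rewrite phi_op.
  by congr op; apply: funext.
pose S := Subuniverse S0 S1.
apply: (qv_iso (qvP K) (A := subalg S)); last first.
  by apply: (qv_sub (qvP K)); apply: (qv_rp (qvP K)).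
have ex (c : subalg S) : exists a, phi a = sval c.
  by have [a _ E] := svalP c; exists a.
have [k kP] := choice ex.
have khom (g : symbol L) (c : fin (arity g) -> subalg S) :
    k (op c) = op (fun i => k (c i)).
  apply: phi_inj; rewrite kP phi_op; change (sval (op c)) with
    (@op L C g (fun i => sval (c i))).
  by congr (@op L C g _); apply: funext => i; rewrite kP.
exists (Hom khom).
exists (fun a => exist _ (phi a) (ex_intro2 _ _ a I erefl)).
  move=> c; have := kP c; rewrite /=; case: c (k c) => c cP a /= E.
  exact: eq_exist.
by move=> a; apply: phi_inj; rewrite /= kP.
Qed.

End Membership.

Section Theta.
Variables (V : Type) (LX LY : language).
Variables (X : quasivariety LX) (Y : quasivariety LY).
Variable T : selective_translation V X Y.

Definition sel_fun (A : algebra LY) (a : A) : A := eval (fun=> a) (selector T).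

Definition fixset (A : algebra LY) : set A := [set a | sel_fun a = a].
Arguments fixset : clear implicits.

Lemma eval_app1 (W : Type) (A : algebra LY) (h : W -> A) (t : term LY W) :
  eval h (app1 (selector T) t) = sel_fun (eval h t).
Proof. by rewrite /app1 eval_subst. Qed.

Lemma sel_fun_hom (A B : algebra LY) (k : hom A B) (a : A) :
  k (sel_fun a) = sel_fun (k a).
Proof. exact: hom_eval. Qed.

Lemma fixset_sel (A : obj Y) (a : A) : fixset A (sel_fun a).
Proof.
have := st_idem T A (objP A) (fun=> a) (@sub0set _ _).
by rewrite /sat /= eval_app1.
Qed.

Lemma fixset_zeta (A : obj Y) (g : symbol LX) (a : fin (arity g) -> A) :
  (forall i, fixset A (a i)) -> fixset A (eval a (zeta T g)).
Proof.
move=> aP; have := st_closed T g A (objP A) a.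
rewrite /sat /= eval_app1; apply => _ [i ->].
by rewrite /sat /= eval_app1; exact: aP.
Qed.

Lemma theta_inh (A : obj Y) : inhabited {a : A | fixset A a}.
Proof.
have [a] := alg_nonempty A.
exact: (inhabits (exist _ (sel_fun a) (fixset_sel a))).
Qed.

Definition theta_alg (A : obj Y) : algebra LX :=
  @Algebra LX {a : A | fixset A a}
    (fun g a => exist _ (eval (fun i => sval (a i)) (zeta T g))
                  (fixset_zeta (fun i => svalP (a i))))
    (theta_inh A).

Lemma eval_zeta_star (A : obj Y) (h : V -> theta_alg A) (t : term LX V) :
  eval (fun x => sval (h x)) (zeta_star (zeta T) (selector T) t)
    = sval (eval h t).
Proof.
elim: t => [x|g ts IH] /=; first by rewrite eval_app1 /=; exact: svalP (h x).
by rewrite eval_subst; congr eval; apply: funext => i.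
Qed.

Lemma theta_in (A : obj Y) : X (theta_alg A).
Proof.
apply: (quasivariety_mem (st_infinite T)) => Phi e XPhi h hPhi.
suff E : sval (eval h e.1) = sval (eval h e.2).
  by rewrite /sat; case: (eval h e.1) (eval h e.2) E => a ? [b ?] /= E;
    apply: eq_exist.
have := st_entails T XPhi A (objP A) (fun x => sval (h x)).
rewrite /sat /= !eval_zeta_star; apply=> _ [[d dPhi <-]|[x ->]].
  by rewrite /sat /= !eval_zeta_star (hPhi _ dPhi).
by rewrite /sat /= eval_app1 /=; exact: svalP (h x).
Qed.

Definition theta (A : obj Y) : obj X := Obj (theta_in A).

Lemma fixset_hom (A B : algebra LY) (h : hom A B) (a : A) :
  fixset A a -> fixset B (h a).
Proof. by rewrite /fixset /= -sel_fun_hom => ->. Qed.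

Lemma theta_mapP (A B : obj Y) (h : hom A B) (g : symbol LX)
    (a : fin (arity g) -> theta A) :
  let r (x : theta A) : theta B :=
    exist _ (h (sval x)) (fixset_hom h (svalP x)) in
  r (op a) = op (fun i => r (a i)).
Proof. by apply: eq_exist => /=; rewrite hom_eval. Qed.

Definition theta_map (A B : obj Y) (h : hom A B) : hom (theta A) (theta B) :=
  Hom (theta_mapP h).

Lemma theta_map_id (A : obj Y) : theta_map (id_hom A) = id_hom (theta A).
Proof. by apply: hom_eq => -[a aP]; apply: eq_exist. Qed.

Lemma theta_map_comp (A B C : obj Y) (k : hom B C) (h : hom A B) :
  @theta_map A C (comp_hom k h) = comp_hom (theta_map k) (theta_map h).
Proof. by apply: hom_eq => a; apply: eq_exist. Qed.

Definition theta_functor : functor Y X := Functor theta_map_id theta_map_comp.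

Definition strongly_selective (F : left_adjoint theta_functor) : Prop :=
  forall A : obj X, bijective (adj_unit F A).

(* Left adjoints being unique up to isomorphism, the choice of F is
   immaterial. *)
Definition sober : Prop := exists F : left_adjoint theta_functor,
  [/\ strongly_selective F,
      forall B : obj Y, injective (adj_counit F B)
    & forall (A B : obj X) (h : hom A B), injective h -> injective (fmap F h)].

(* The relation B <=_f A, for the subalgebra B of A with universe S. *)
Definition f_subalgebra (A : algebra LY) (S : subuniverse A) : Prop :=
  [set sval b | b in fixset (subalg S)] = fixset A.

Definition up (K : set (algebra LY)) : set (algebra LY) :=
  [set A | Y A /\ exists2 S : subuniverse A, f_subalgebra S & K (subalg S)].

Lemma f_subalgebraE (A : algebra LY) (S : subuniverse A) :
  f_subalgebra S <-> fixset A `<=` S.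
Proof.
have incl : forall (g : symbol LY) (a : fin (arity g) -> subalg S),
  sval (op a) = op (fun i => sval (a i)) by [].
have fixE (b : subalg S) : fixset (subalg S) b <-> fixset A (sval b).
  rewrite /fixset /=; have -> : sel_fun (sval b) = sval (sel_fun b).
    by rewrite -(sel_fun_hom (Hom incl)).
  split=> [-> //|]; case: b => c cP; case: (sel_fun _) => a aP /= E.
  exact: eq_exist.
rewrite /f_subalgebra; split=> [<- a [b _ <-]|sub]; first by case: b.
apply/seteqP; split=> [a [b bf <-]|a fa]; first exact/fixE.
by exists (exist _ a (sub _ fa)) => //; apply/fixE.
Qed.

End Theta.

Arguments fixset {V LX LY X Y} T A.

(* A family of subsets of T with a largest member, closed under nonempty
   intersections; its members form a complete lattice under inclusion. *)
Record closure_system (T : Type) := ClosureSystem {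
  cs_set :> set (set T);
  cs_top : exists2 U, cs_set U & forall K, cs_set K -> K `<=` U;
  cs_cap : forall C : set (set T), C !=set0 -> C `<=` cs_set ->
    cs_set (\bigcap_(K in C) K)
}.

Section ClosureLattice.
Variables (T : Type) (C : closure_system T).

Definition closed_of : Type := {K : set T | C K}.

Definition closed_set (K : closed_of) : set T := sval K.

HB.instance Definition _ := gen_eqMixin closed_of.
HB.instance Definition _ := gen_choiceMixin closed_of.

Definition closed_le (K M : closed_of) : bool :=
  `[< closed_set K `<=` closed_set M >].

Lemma closed_le_refl : reflexive closed_le.
Proof. by move=> K; apply/asboolP. Qed.

Lemma closed_le_anti : antisymmetric closed_le.
Proof.
move=> [K KC] [M MC] /andP[/asboolP KM /asboolP MK]; apply: eq_exist.
exact/seteqP.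
Qed.

Lemma closed_le_trans : transitive closed_le.
Proof.
by move=> M K N /asboolP KM /asboolP MN; apply/asboolP; exact: subset_trans MN.
Qed.

Fact closed_display : Order.disp_t. Proof. exact: Order.Disp tt tt. Qed.

HB.instance Definition _ := Order.Le_isPOrder.Build closed_display closed_of
  closed_le_refl closed_le_anti closed_le_trans.

Lemma closed_meet_subproof (K M : closed_of) :
  C (closed_set K `&` closed_set M).
Proof.
rewrite -bigcap2E; have -> : \bigcap_i bigcap2 (closed_set K) (closed_set M) i
  = \bigcap_(N in [set closed_set K; closed_set M]) N.
  rewrite bigcap2E; apply/seteqP; split=> [x [Kx Mx] _ [->|->] //|x H].
  by split; apply: H; [left|right].
apply: cs_cap; first by exists (closed_set K); left.
by move=> _ [->|->]; exact: svalP.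
Qed.

Definition closed_meet (K M : closed_of) : closed_of :=
  exist _ _ (closed_meet_subproof K M).

Lemma closed_join_subproof (K M : closed_of) :
  C (\bigcap_(N in [set N | C N /\ closed_set K `|` closed_set M `<=` N]) N).
Proof.
apply: cs_cap; last by move=> N [].
have [U CU Umax] := cs_top C; exists U; split => //.
by move=> x [Kx|Mx]; [apply: Umax (svalP K) _ Kx|apply: Umax (svalP M) _ Mx].
Qed.

Definition closed_join (K M : closed_of) : closed_of :=
  exist _ _ (closed_join_subproof K M).

Lemma closed_meetP (K M N : closed_of) :
  closed_le K (closed_meet M N) = closed_le K M && closed_le K N.
Proof.
apply/asboolP/andP => [|[/asboolP KM /asboolP KN]]; rewrite /= ?subsetI //.
by case=> KM KN; split; apply/asboolP.
Qed.

Lemma closed_joinP (K M N : closed_of) :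
  closed_le (closed_join K M) N = closed_le K N && closed_le M N.
Proof.
apply/asboolP/andP => [H|[/asboolP KN /asboolP MN]].
  by split; apply/asboolP => x h; apply: H => P [_]; apply; [left|right].
by move=> x; apply; split; [exact: svalP|rewrite subUset].
Qed.

HB.instance Definition _ :=
  Order.POrder_MeetJoin_isLattice.Build closed_display closed_of
    closed_meetP closed_joinP.

End ClosureLattice.

Section Xi.
Variables (L : language) (X : quasivariety L).

Definition subquasivariety : set (set (algebra L)) :=
  [set K | is_quasivariety K /\ K `<=` X].

Lemma subquasivariety_top : exists2 U, subquasivariety U &
  forall K, subquasivariety K -> K `<=` U.
Proof. by exists X; [split=> //; exact: qvP|move=> K []]. Qed.

Lemma subquasivariety_cap (C : set (set (algebra L))) : C !=set0 ->
  C `<=` subquasivariety -> subquasivariety (\bigcap_(K in C) K).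
Proof.
move=> [K0 CK0] sub; split; last first.
  by move=> A /(_ _ CK0); have [_] := sub _ CK0; apply.
split.
- move=> A B AB CA K CK; have [[iso _ _] _] := sub _ CK.
  exact: iso AB (CA _ CK).
- move=> A S CA K CK; have [[_ sb _] _] := sub _ CK.
  exact: sb (CA _ CK).
- move=> I A F FF CA K CK; have [[_ _ rp] _] := sub _ CK.
  by apply: rp => i; exact: CA.
Qed.

Definition Xi : Type :=
  closed_of (ClosureSystem subquasivariety_top subquasivariety_cap).

End Xi.

Section Xif.
Variables (V : Type) (LX LY : language).
Variables (X : quasivariety LX) (Y : quasivariety LY).
Variable T : selective_translation V X Y.

Definition f_quasivariety : set (set (algebra LY)) :=
  [set up T K | K in subquasivariety Y].

Lemma f_quasivariety_top : exists2 U, f_quasivariety U &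
  forall K, f_quasivariety K -> K `<=` U.
Proof.
exists (up T Y).
  by exists Y => //; split=> //; exact: qvP.
move=> _ [K [_ KY] <-] A [YA [S fS KS]]; split=> //; exists S => //.
exact: KY.
Qed.

Lemma subalg_le (K : set (algebra LY)) (A : algebra LY) (S S' : subuniverse A) :
  is_quasivariety K -> S `<=` S' -> K (subalg S') -> K (subalg S).
Proof.
move=> qK sub KS'; pose R : set (subalg S') := [set b | S (sval b)].
have R0 : R !=set0.
  by case: (su_nonempty S) => a Sa; exists (exist _ a (sub _ Sa)).
have R1 (g : symbol LY) (a : fin (arity g) -> subalg S') :
  (forall i, R (a i)) -> R (op a) by move=> H; exact: su_closed H.
apply: (qv_iso qK (A := subalg (Subuniverse R0 R1))); last exact: qv_sub.
pose h (b : subalg (Subuniverse R0 R1)) : subalg S :=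
  exist _ (sval (sval b)) (svalP b).
have hP (g : symbol LY) (b : fin (arity g) -> subalg (Subuniverse R0 R1)) :
  h (op b) = op (fun i => h (b i)) by exact: eq_exist.
exists (Hom hP).
pose k (a : subalg S) : subalg (Subuniverse R0 R1) :=
  exist R (exist S' (sval a) (sub _ (svalP a))) (svalP a).
exists k => [[[a S'a] Ra]|[a Sa]]; last exact: eq_exist.
by apply: eq_exist; exact: eq_exist.
Qed.

Lemma f_quasivariety_cap (C : set (set (algebra LY))) : C !=set0 ->
  C `<=` f_quasivariety -> f_quasivariety (\bigcap_(K in C) K).
Proof.
move=> [K0 CK0] sub; pose D := [set K | subquasivariety Y K /\ C (up T K)].
have D0 : D !=set0 by case: (sub _ CK0) => K KY E; exists K; split; rewrite ?E.
exists (\bigcap_(K in D) K); first by apply: subquasivariety_cap => // K [].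
apply/seteqP; split=> A.
  move=> [YA [S fS DS]] M CM; have [K KY E] := sub _ CM.
  rewrite -E; split=> //; exists S => //.
  by apply: DS; split; rewrite ?E.
move=> CA.
have YA : Y A by have [K KY E] := sub _ CK0; have := CA _ CK0; rewrite -E => -[].
pose G : set A := [set a | forall S : subuniverse A, fixset T A `<=` S -> S a].
have G0 : G !=set0.
  have [a] := alg_nonempty A; exists (sel_fun T a) => S; apply.
  exact: (@fixset_sel _ _ _ _ _ T (Obj YA)).
have G1 (g : symbol LY) (a : fin (arity g) -> A) :
    (forall i, G (a i)) -> G (op a).
  by move=> H S fS; apply: su_closed => i; exact: H.
split=> //; exists (Subuniverse G0 G1).
  by apply/f_subalgebraE => a fa S; exact.
move=> K [[qK KY] CK]; have [_ [S /f_subalgebraE fS KS]] := CA _ CK.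
by apply: subalg_le KS => // a; exact.
Qed.

Definition Xif : Type :=
  closed_of (ClosureSystem f_quasivariety_top f_quasivariety_cap).

End Xif.

Definition lattice_isomorphism (d d' : Order.disp_t) (P : latticeType d)
    (Q : latticeType d') (t : P -> Q) : Prop :=
  [/\ bijective t, Order.meet_morphism t & Order.join_morphism t].

(* Main.v *)
Require Import Defs.
From mathcomp Require Import all_boot all_order.
From mathcomp Require Import boolp classical_sets.
From mathcomp Require Import filter.

(** Closure under isomorphisms and subalgebras amounts to closure under
    embeddings, and [theta] preserves embeddings and commutes with reduced
    products; hence [tau K] is a subquasivariety of [Y], and it is [up]-closed
    since [theta] does not distinguish [A] from its f-subalgebras.  As
    [A] is isomorphic to [theta (F A)], [tau] is an order embedding.  For
    surjectivity, [up M] is the image of [{A | F A in M}]: this class is a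
    subquasivariety because [F] preserves embeddings, and because a reduced
    product of the [A_i] embeds into [theta B], with [B] the reduced product of
    the [F A_i], so that its image under [F] embeds into [F (theta B)], and
    hence into [B] through the counit.  Finally, by the triangle identity, the
    counit exhibits [F (theta A)] as an f-subalgebra of [A]. *)

Set Implicit Arguments.
Unset Strict Implicit.
Unset Printing Implicit Defensive.

Import Order.LTheory.

Local Open Scope classical_set_scope.

(** * Embeddings of algebras *)

Section Embeddings.
Variable L : language.

Lemma inverse_hom (A B : algebra L) (h : hom A B) :
  bijective h -> exists k : hom B A, cancel h k /\ cancel k h.
Proof.
case=> k hK kK.
have kP (g : symbol L) (b : fin (arity g) -> B) :
    k (op b) = op (fun i => k (b i)).
  by apply: (can_inj hK); rewrite homP kK; congr op; apply: funext => i.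
by exists (Hom kP).
Qed.

Lemma isomorphic_sym (A B : algebra L) : isomorphic A B -> isomorphic B A.
Proof. by case=> h /inverse_hom [k [hK kK]]; exists k; exists h. Qed.

Lemma inj_surj_bij (A B : Type) (h : A -> B) :
  injective h -> (forall b, exists a, h a = b) -> bijective h.
Proof.
by move=> hI /choice [k kP]; exists k => // a; apply: hI; rewrite kP.
Qed.

Lemma range_closed (A B : algebra L) (h : hom A B) (g : symbol L)
    (b : fin (arity g) -> B) :
  (forall i, range h (b i)) -> range h (op b).
Proof.
move=> H; have /choice [a aP] i : exists a, h a = b i.
  by case: (H i) => a _; exists a.
by exists (op a) => //; rewrite homP; congr op; apply: funext.
Qed.

Lemma range_nonempty (A B : algebra L) (h : hom A B) : range h !=set0.
Proof. by have [a] := alg_nonempty A; exists (h a), a. Qed.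

Definition range_su (A B : algebra L) (h : hom A B) : subuniverse B :=
  Subuniverse (range_nonempty h) (range_closed (h := h)).

Lemma range_iso (A B : algebra L) (h : hom A B) :
  injective h -> isomorphic A (subalg (range_su h)).
Proof.
move=> hI; pose r (a : A) : subalg (range_su h) :=
  exist _ (h a) (imageP h (I : [set: A] a)).
have rP (g : symbol L) (a : fin (arity g) -> A) :
  r (op a) = op (fun i => r (a i)) by apply: eq_exist; exact: homP.
exists (Hom rP); apply: inj_surj_bij => [a b /(congr1 sval) /hI //|].
by case=> b [a ? E]; exists a; exact: eq_exist.
Qed.

Definition incl_hom (A : algebra L) (S : subuniverse A) : hom (subalg S) A :=
  @Hom L (subalg S) A sval (fun _ _ => erefl).

Lemma incl_inj (A : algebra L) (S : subuniverse A) : injective (incl_hom S).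
Proof. by case=> a ? [b ?] /= E; exact: eq_exist. Qed.


(** The source of an embedding is isomorphic to its range, a subalgebra of the target. *)
Lemma qv_embed (K : set (algebra L)) (A B : algebra L) (h : hom A B) :
  is_quasivariety K -> injective h -> K B -> K A.
Proof.
move=> qK /range_iso /isomorphic_sym iso KB.
exact: (qv_iso qK iso (qv_sub qK (range_su h) KB)).
Qed.

Lemma is_quasivarietyI (K : set (algebra L)) :
    (forall (A B : algebra L) (h : hom A B), injective h -> K B -> K A) ->
    (forall (I : Type) (A : I -> algebra L) (F : set_system I),
      Filter F -> (forall i, K (A i)) -> K (reduced_product A F)) ->
  is_quasivariety K.
Proof.
move=> emb rp; split=> //.
- by move=> A B /isomorphic_sym [h /bij_inj hI]; exact: emb hI.
- by move=> A S; exact: emb (@incl_inj A S).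
Qed.

End Embeddings.

(** * Terms and embeddings in reduced products *)

Section ReducedProducts.
Variables (L : language) (I : Type) (F : set_system I).
Hypothesis FF : Filter F.

(** Extends [rp_op] from symbols to terms, since the selector and each [zeta g] are terms. *)
Lemma eval_rp_pi (W : Type) (A : I -> algebra L) (a : W -> forall i, A i)
    (t : term L W) :
  eval (A := reduced_product A F) (fun x => rp_pi F (a x)) t
    = rp_pi F (fun i => eval (fun x => a x i) t).
Proof.
elim: t => [//|g ts IH] /=.
rewrite -[RHS](rp_op FF (fun k i => eval (fun x => a x i) (ts k))).
by congr (@op L (reduced_product A F) g _); apply: funext.
Qed.

(** Representatives are chosen, so a family is recovered from its class only on a set of [F]. *)
Lemma rp_repr_pi (A : I -> algebra L) (a : forall i, A i) :
  F [set i | rp_repr (rp_pi F a) i = a i].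
Proof. by apply/(rp_pi_eq FF); rewrite rp_reprK. Qed.

Lemma rp_embed (A B : I -> algebra L) (h : forall i, hom (A i) (B i)) :
  (forall i, injective (h i)) ->
  exists k : hom (reduced_product A F) (reduced_product B F), injective k.
Proof.
move=> hI; pose k (c : reduced_product A F) : reduced_product B F :=
  rp_pi F (fun i => h i (rp_repr c i)).
have kP (g : symbol L) (c : fin (arity g) -> reduced_product A F) :
    k (op c) = op (fun i => k (c i)).
  rewrite (rp_op FF); apply/(rp_pi_eq FF).
  have := rp_repr_pi (fun i => op (fun k => rp_repr (c k) i)).
  by apply: filterS => i /= ->; rewrite homP.
exists (Hom kP) => c d /(rp_pi_eq FF) E.
rewrite -(rp_reprK c) -(rp_reprK d); apply/(rp_pi_eq FF).
by apply: filterS E => i /hI.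
Qed.

End ReducedProducts.

(** * The functor theta, its left adjoint, and preimages of classes *)

Section Theta.
Variables (V : Type) (LX LY : language).
Variables (X : quasivariety LX) (Y : quasivariety LY).
Variable T : selective_translation V X Y.

(** Preimage classes rebuild an object from its algebra and some membership proof; the choice of
    proof is immaterial. *)
Lemma obj_eta (L : language) (K : set (algebra L)) (A : obj K) (KA : K A) :
  Obj KA = A.
Proof. by case: A KA => A KA' KA; rewrite (Prop_irrelevance KA KA'). Qed.

Lemma theta_map_inj (A B : obj Y) (h : hom A B) :
  injective h -> injective (theta_map T h).
Proof.
by move=> hI [a ?] [b ?] /(congr1 sval) /= /hI E; exact: eq_exist.
Qed.

Lemma theta_f_subalgebra (A : obj Y) (S : subuniverse A)
    (YS : Y (subalg S)) :
  f_subalgebra T S -> isomorphic (theta T (Obj YS)) (theta T A).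
Proof.
move=> fS; exists (@theta_map _ _ _ _ _ T (Obj YS) A (incl_hom S)).
apply: inj_surj_bij; first exact/theta_map_inj/incl_inj.
(* Surjectivity is the equality of fixed-point sets in [fS]. *)
case=> a fa; have := fa; rewrite -[X in X a -> _]fS => -[b fb E].
by exists (exist _ b fb); exact: eq_exist.
Qed.

Lemma theta_reduced_product (I : Type) (A : I -> obj Y) (F : set_system I)
    (YA : Y (reduced_product A F)) :
  Filter F ->
  isomorphic (reduced_product (fun i => theta T (A i)) F) (theta T (Obj YA)).
Proof.
move=> FF; set P := reduced_product _ F.
have selE (a : forall i, A i) :
  sel_fun T (rp_pi F a : reduced_product A F)
    = rp_pi F (fun i => sel_fun T (a i)) by exact: eval_rp_pi.
have fixP (a : forall i, theta T (A i)) :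
    Defs.fixset T (reduced_product A F) (rp_pi F (fun i => sval (a i))).
  rewrite /Defs.fixset /= selE; congr rp_pi.
  by apply: functional_extensionality_dep => i; exact: svalP (a i).
pose k (c : P) : theta T (Obj YA) := exist _ _ (fixP (rp_repr c)).
have kP (g : symbol LX) (c : fin (arity g) -> P) :
    k (op c) = op (fun i => k (c i)).
  apply: eq_exist => /=; rewrite eval_rp_pi; apply/(rp_pi_eq FF).
  have := rp_repr_pi FF (fun i => op (fun k => rp_repr (c k) i)).
  by apply: filterS => i /= ->.
exists (Hom kP); apply: inj_surj_bij => [c d /(congr1 sval)|[d fd]].
  move=> /(rp_pi_eq FF) E.
  rewrite -(rp_reprK c) -(rp_reprK d); apply/(rp_pi_eq FF).
  apply: filterS E => i /=.
  by case: (rp_repr c i) (rp_repr d i) => [a fa] [b fb] /= E'; exact: eq_exist.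
(* A representative of [d] need be fixed only on a set of [F]. Applying the selector makes every
   coordinate fixed, and keeps the class because [d] itself is fixed. *)
pose c i : theta T (A i) := exist _ _ (fixset_sel T (rp_repr d i)).
exists (rp_pi F c); apply: eq_exist => /=.
transitivity (rp_pi F (fun i => sel_fun T (rp_repr d i))).
  by apply/(rp_pi_eq FF); apply: filterS (rp_repr_pi FF c) => i /= ->.
by rewrite -selE rp_reprK.
Qed.

Definition theta_preimage (K : set (algebra LX)) : set (algebra LY) :=
  [set A | exists YA : Y A, K (theta T (Obj YA))].

Lemma theta_preimage_qv (K : set (algebra LX)) :
  is_quasivariety K -> subquasivariety Y (theta_preimage K).
Proof.
move=> qK; split; last by move=> A [].
apply: is_quasivarietyI => [A B h hI [YB KB]|I A F FF KA].
  have YA := qv_embed (qvP Y) hI YB; exists YA.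
  exact: (qv_embed qK (@theta_map_inj (Obj YA) (Obj YB) h hI) KB).
pose A' i : obj Y := Obj (projT1 (cid (KA i))).
have YA : Y (reduced_product A F).
  by apply: (qv_rp (qvP Y)) => i; case: (KA i).
exists YA; apply: (qv_iso qK (@theta_reduced_product I A' F YA FF) _).
by apply: (qv_rp qK) => i; exact: projT2 (cid (KA i)).
Qed.

Lemma up_theta_preimage (K : set (algebra LX)) :
  is_quasivariety K -> up T (theta_preimage K) = theta_preimage K.
Proof.
move=> qK; apply/seteqP; split=> A; last first.
  move=> [YA KA]; split=> //.
  have T0 : [set: A] !=set0 by have [a] := alg_nonempty A; exists a.
  (* Every algebra is an f-subalgebra of itself. *)
  pose S := @Subuniverse LY A setT T0 (fun _ _ _ => I).
  exists S; first exact/f_subalgebraE.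
  have [qtau _] := theta_preimage_qv qK.
  by apply: (qv_sub qtau); exists YA.
move=> [YA [S fS [YS KS]]]; exists YA.
exact: (qv_iso qK (@theta_f_subalgebra (Obj YA) S YS fS) KS).
Qed.

Lemma theta_preimage_f_quasivariety (K : set (algebra LX)) :
  is_quasivariety K -> f_quasivariety T (theta_preimage K).
Proof.
by move=> qK; exists (theta_preimage K);
  [exact: theta_preimage_qv|exact: up_theta_preimage].
Qed.

Variable F : left_adjoint (theta_functor T).

Lemma theta_preimage_le (K M : set (algebra LX)) :
    strongly_selective F -> subquasivariety X K -> is_quasivariety M ->
  theta_preimage K `<=` theta_preimage M -> K `<=` M.
Proof.
move=> eta_bij [qK KX] qM sub A KA; pose A' := Obj (KX _ KA).
have eta_iso : isomorphic A (theta T (F A')).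
  by exists (adj_unit F A'); exact: eta_bij.
(* The inclusion is tested at [F A'], whose image under theta is a copy of [A]. *)
have [|YFA] := sub (F A').
  by exists (objP (F A')); rewrite obj_eta; exact: (qv_iso qK eta_iso KA).
by rewrite obj_eta; exact: (qv_iso qM (isomorphic_sym eta_iso)).
Qed.

(** The class that [tau] will send to [up T M]. *)
Definition left_preimage (M : set (algebra LY)) : set (algebra LX) :=
  [set A | exists XA : X A, M (F (Obj XA))].

Hypothesis eta_inj : forall A : obj X, injective (adj_unit F A).
Hypothesis eps_inj : forall B : obj Y, injective (adj_counit F B).
Hypothesis F_inj :
  forall (A B : obj X) (h : hom A B), injective h -> injective (Defs.fmap F h).

Lemma left_preimage_qv (M : set (algebra LY)) :
  subquasivariety Y M -> subquasivariety X (left_preimage M).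
Proof.
move=> [qM MY]; split; last by move=> A [].
apply: is_quasivarietyI => [A B h hI [XB MB]|I A G FG MA].
  have XA := qv_embed (qvP X) hI XB; exists XA.
  exact: (qv_embed qM (@F_inj (Obj XA) (Obj XB) h hI) MB).
pose A' i : obj X := Obj (projT1 (cid (MA i))).
have MB : M (reduced_product (fun i => F (A' i)) G).
  by apply: (qv_rp qM) => i; exact: projT2 (cid (MA i)).
pose B : obj Y := Obj (MY _ MB).
have XA : X (reduced_product A G).
  by apply: (qv_rp (qvP X)) => i; case: (MA i).
exists XA.
(* [k] is induced by the units; [l] identifies its target with [theta T B]. *)
have [k kI] := rp_embed FG (fun i => @eta_inj (A' i)).
have [l /bij_inj lI] := theta_reduced_product (MY _ MB) FG.
have lkI : injective (comp_hom l k) by exact: inj_comp lI kI.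
(* The embedding into [B] is the transpose of [comp_hom l k] under the adjunction. *)
apply: (qv_embed (h := comp_hom (adj_counit F B)
  (@Defs.fmap _ _ _ _ F (Obj XA) (theta T B) (comp_hom l k))) qM _ MB).
exact: inj_comp (@eps_inj B)
  (@F_inj (Obj XA) (theta T B) (comp_hom l k) lkI).
Qed.

Lemma counit_f_subalgebra (A : obj Y) :
  f_subalgebra T (range_su (adj_counit F A)).
Proof.
apply/f_subalgebraE => a fa.
pose a' : theta T A := exist _ a fa.
(* By the triangle identity, the counit sends the unit's value at a fixed point back to that
   point. *)
exists (sval (adj_unit F (theta T A) a')) => //.
have /(congr1 (fun h : hom (theta T A) (theta T A) => sval (h a'))) := adj_triangle_r F A.
exact.
Qed.

Lemma theta_left_preimage (M : set (algebra LY)) :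
  subquasivariety Y M -> theta_preimage (left_preimage M) = up T M.
Proof.
move=> sM; have [qM MY] := sM; apply/seteqP; split=> A.
  move=> [YA [XA MA]]; split=> //; pose A' : obj Y := Obj YA.
  exists (range_su (adj_counit F A')); first exact: (counit_f_subalgebra A').
  apply: (qv_iso qM (range_iso (@eps_inj A')) _).
  by move: MA; rewrite (@obj_eta _ _ (theta T A') XA).
move=> [YA [S fS MS]]; exists YA.
have [qL _] := left_preimage_qv sM.
apply: (qv_iso qL (@theta_f_subalgebra (Obj YA) S (MY _ MS) fS) _).
(* The counit embeds [F (theta S)] into [S], which lies in [M]. *)
by exists (theta_in T _); exact: (qv_embed qM (@eps_inj (Obj (MY _ MS))) MS).
Qed.

End Theta.

Lemma lattice_isomorphism_of_le (d d' : Order.disp_t) (P : latticeType d)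
    (Q : latticeType d') (t : P -> Q) :
    (forall x y, (t x <= t y)%O = (x <= y)%O) ->
    (forall z, exists x, t x = z) ->
  lattice_isomorphism t.
Proof.
move=> t_le t_surj; split.
- apply: inj_surj_bij => // x y E; apply: le_anti.
  by rewrite -!t_le E lexx.
(* As [t] reflects the order, the preimage [z] of the meet lies below [x] and [y], hence below their
   meet. Joins are dual. *)
- move=> x y; have [z zE] := t_surj (Order.meet (t x) (t y)).
  apply: le_anti; rewrite lexI !t_le.
  rewrite leIl leIr -zE t_le.
  rewrite lexI -!t_le zE.
  by rewrite leIl leIr.
- move=> x y; have [z zE] := t_surj (Order.join (t x) (t y)).
  apply: le_anti; rewrite leUx !t_le.
  rewrite leUl leUr -zE t_le.
  rewrite leUx -!t_le zE.
  by rewrite leUl leUr.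
Qed.

Theorem proposition6p14 (V : Type) (LX LY : language)
    (X : quasivariety LX) (Y : quasivariety LY)
    (T : selective_translation V X Y) (soberT : sober T) :
  exists tau : Xi X -> Xif T,
    (forall K : Xi X, closed_set (tau K)
       = [set A | exists YA : Y A, closed_set K (theta T (Obj YA))]) /\
    lattice_isomorphism tau.
Proof.
have [F [eta_bij eps_inj F_inj]] := soberT.
have eta_inj A := bij_inj (eta_bij A).
pose tau (K : Xi X) : Xif T :=
  exist _ _ (theta_preimage_f_quasivariety T (proj1 (svalP K))).
exists tau.
split=> //; apply: lattice_isomorphism_of_le.
- move=> K M; apply/asboolP/asboolP => [|KM A [YA KA]].
    exact: theta_preimage_le eta_bij (svalP K) (proj1 (svalP M)).
  by exists YA; exact: KM.
(* A member of [Xif T] is some [up T M]; its preimage is built from any such [M]. *)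
- move=> [N [M sM E]].
  exists (exist _ _ (left_preimage_qv eta_inj eps_inj F_inj sM)).
  by apply: eq_exist; rewrite -E; exact: theta_left_preimage.
Qed.
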